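(* Let $n$ be an even positive integer and let $D=(V,A)$ be an acyclic digraph on $|V|=n$ vertices. Then $$\mathrm{DIN}(D)\le \frac{5n^2}{8}-\frac{3n}{4}+1 .$$
   Context: All digraphs are finite and simple; an arc $(u,v)\in A$ has tail $u$ and head $v$. An acyclic digraph is one with no directed cycles. A directed intersection representation of a digraph $D=(V,A)$ is an assignment $\varphi$ of a nonempty subset $\varphi(v)\subseteq\mathcal{C}$ of a finite ground set $\mathcal{C}$ (the color set) to each vertex $v\in V$ such that, for all distinct $u,v\in V$, $(u,v)\in A$ if and only if $|\varphi(u)\cap\varphi(v)|\ge 1$ and $|\varphi(u)|<|\varphi(v)|$. Every acyclic digraph admits a directed intersection representation. The directed intersection number $\mathrm{DIN}(D)$ is the smallest cardinality of a ground set $\mathcal{C}$ for which $D$ admits a directed intersection representation. *)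

(* Defs.v *)
From mathcomp Require Import all_boot.

Set Implicit Arguments.
Unset Strict Implicit.
Unset Printing Implicit Defensive.

(* A simple digraph on the vertex set T is an irreflexive e : rel T, with     *)
(* e u v meaning that there is an arc from the tail u to the head v.          *)

(* ucycle e c : c = [:: x_0; ...; x_m] has pairwise distinct entries and      *)
(* e x_0 x_1, ..., e x_m x_0; the library also accepts the empty sequence.    *)
Definition acyclic (T : finType) (e : rel T) : Prop :=
  forall c : seq T, ucycle e c -> c = [::].

Definition dir_rep (T : finType) (e : rel T) (C : finType)
    (phi : {ffun T -> {set C}}) : bool :=
  [forall v, phi v != set0] &&
  [forall u, forall v, (u != v) ==>
     (e u v == ((1 <= #|phi u :&: phi v|) && (#|phi u| < #|phi v|)))].

(* Only the cardinality of the color set matters (see has_dir_rep_card), so   *)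
(* the color sets 'I_k suffice.                                               *)
Definition has_dir_rep (T : finType) (e : rel T) (k : nat) : bool :=
  [exists phi : {ffun T -> {set 'I_k}}, dir_rep e phi].

Lemma has_dir_rep_card (T : finType) (e : rel T) (C : finType)
    (phi : {ffun T -> {set C}}) : dir_rep e phi -> has_dir_rep e #|C|.
Proof.
case/andP=> /forallP phi0 /forallP phiE; apply/existsP.
have inj_r := @enum_rank_inj C.
exists [ffun v => [set enum_rank c | c in phi v]]; apply/andP; split.
  apply/forallP=> v; rewrite ffunE -card_gt0 card_imset // card_gt0.
  exact: phi0.
apply/forallP=> u; apply/forallP=> v; rewrite !ffunE -imsetI; last first.
  by move=> x y _ _; apply: inj_r.
by rewrite !card_imset //; move/forallP: (phiE u).
Qed.

Lemma acyclic_has_dir_rep (T : finType) (e : rel T) :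
  acyclic e -> exists k, has_dir_rep e k.
Proof.
move=> acy.
pose r v := #|[set u | connect e u v]|.
have r_lt u v : e u v -> r u < r v.
  move=> euv; apply/proper_card/properP; split.
    apply/subsetP=> w; rewrite !inE => cwu.
    exact: connect_trans cwu (connect1 euv).
  exists v; rewrite !inE ?connect0 //; apply/negP=> /connectP[p pth lst].
  case/shortenP: pth lst => q qp uq _ lst.
  have /acy // : ucycle e (v :: q).
  by rewrite /ucycle uq andbT /= rcons_path qp -lst.
have r_le v : r v <= #|T| by apply: max_card.
have r_gt0 v : 0 < r v by apply/card_gt0P; exists v; rewrite inE connect0.
pose K := #|{: T * T}|.+1.
pose B := K * #|T|.
pose C : finType := ((T * T) + (T * 'I_B))%type.
pose I v := [set a : T * T | e a.1 a.2 && ((a.1 == v) || (a.2 == v))].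
pose P v := [set c : T * 'I_B | (c.1 == v) && (c.2 < K * r v)].
pose phi := [ffun v => (inl @: I v) :|: (inr @: P v) : {set C}].
have inlE v a : (inl a \in phi v) = (a \in I v).
  rewrite ffunE in_setU mem_imset; last by move=> ? ? [].
  by rewrite orbC; case: imsetP => // -[].
have inrE v a : (inr a \in phi v) = (a \in P v).
  rewrite ffunE in_setU [X in _ || X]mem_imset; last by move=> ? ? [].
  by case: imsetP => // -[].
have cardP v : #|P v| = K * r v.
  have leB : K * r v <= B by rewrite leq_mul2l r_le orbT.
  pose g (i : 'I_(K * r v)) := (v, widen_ord leB i).
  have -> : P v = g @: 'I_(K * r v).
    apply/setP=> -[w i]; rewrite inE /=; apply/andP/imsetP.
      by case=> /eqP-> lti; exists (Ordinal lti) => //; congr pair; apply: val_inj.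
    by case=> j _ [-> ->]; rewrite eqxx /=.
  rewrite card_imset ?card_ord //.
  by move=> i j [ij]; apply: val_inj.
have card_phi v : #|phi v| = #|I v| + K * r v.
  rewrite ffunE cardsU (_ : _ :&: _ = set0).
    rewrite cards0 subn0 !card_imset ?cardP //; by move=> ? ? [].
  apply/setP=> x; rewrite !inE; apply/negP=> /andP[/imsetP[a _ ->] /imsetP[]] //.
have phi_lt u v : e u v -> #|phi u| < #|phi v|.
  move=> /r_lt ruv; rewrite !card_phi.
  apply: (@leq_trans (K * (r u).+1)); last first.
    by apply: leq_trans (leq_addl _ _); rewrite leq_mul2l ruv orbT.
  by rewrite mulnS ltn_add2r ltnS max_card.
exists #|C|; apply: (@has_dir_rep_card _ _ _ phi); apply/andP; split.
  apply/forallP=> v; rewrite -card_gt0 card_phi addn_gt0 orbC.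
  by rewrite muln_gt0 /K r_gt0.
apply/forallP=> u; apply/forallP=> v; apply/implyP=> uv; apply/eqP.
apply/idP/andP=> [euv|[/card_gt0P[[a|a]]]].
  split; last exact: phi_lt.
  by apply/card_gt0P; exists (inl (u, v)); rewrite inE !inlE !inE /= euv !eqxx orbT.
- rewrite inE !inlE !inE; case: a => a b /= /andP[/andP[eab abu] /andP[_ abv]].
  move=> ltuv; case/orP: abu => /eqP abu; case/orP: abv => /eqP abv; subst=> //.
  + by rewrite eqxx in uv.
  + by move: (phi_lt _ _ eab); rewrite ltnNge (ltnW ltuv).
  + by rewrite eqxx in uv.
- rewrite inE !inrE !inE => /andP[/andP[/eqP-> _] /andP[/eqP auv _]].
  by rewrite auv eqxx in uv.
Qed.

Definition DIN (T : finType) (e : rel T) (acy : acyclic e) : nat :=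
  ex_minn (acyclic_has_dir_rep acy).

(* Main.v *)
Require Import Defs.
From mathcomp Require Import all_boot all_order all_algebra.
From mathcomp Require Import zify lra.

Set Implicit Arguments.
Unset Strict Implicit.
Unset Printing Implicit Defensive.

Import Order.TTheory GRing.Theory Num.Theory.
Local Open Scope ring_scope.

(** A representation is handled dually, as the list of its color classes: a
color is the set of the vertices that carry it, the size of the color set of v
is the number of classes containing v, and two color sets meet when a class
contains both vertices.

The classes are built by induction on the number of pairs of vertices: from
2m + 2 vertices, two vertices x and y that come last in a topological order are
removed. Given classes for the other 2m vertices, each old vertex z receives one fresh color, shared with those of x
and y that are adjacent to z. All old sizes grow by one, so their comparisons
are unchanged, and every arc into x or y is witnessed (in the manner of the
Erdos-Goodman-Posa covering of a graph by edges and triangles). Then x and y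
are filled up to prescribed sizes X <= Y, exceeding all sizes of their
in-neighbors, by padding colors, as many as possible of which are common to x
and y. The cost is 2m + max (X - deg x, Y - deg y), and the target allows
5m + 1 new colors when passing from m to m + 1 pairs, hence a maximum of
3m + 1.

Old sizes are below 3m, so below 3m + 1 after the growth. If x and y are not
adjacent, both get size 3m + 1: sharing padding colors is harmless at equal
sizes. If there is an arc from x to y, sizes 3m + 1 and 3m + 2 are affordable
unless y has no in-neighbor but x, when one color too many is used. For m = 0
it is paid by the constant term of the bound; for m > 0 two facts repair this.

- If the digraph has no Hamiltonian path, its sizes can be kept smaller by one
  (step_untraceable), so that y costs one color less.
- If it has a Hamiltonian path, consider the path v_1, ..., v_2m preceding x.
  When two consecutive vertices of it are both in-neighbors of x, or both are
  not, they can share one fresh color (bumps_merge). Otherwise the in-neighbors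
  of x alternate along the path; as v_2m is one of them, v_1 is not, and as the
  smallest vertex v_1 does not need to grow: it gets no fresh color
  (bumps_skip). *)

(** * Color classes *)
Section ColorClasses.
Local Open Scope nat_scope.
Variables (T : finType) (e : rel T).
Implicit Types (s gs : seq {set T}) (V G : {set T}).

Definition ncol s v := count (fun G : {set T} => v \in G) s.
Definition share s u v := has (fun G : {set T} => (u \in G) && (v \in G)) s.

(** The restriction of a directed intersection representation to the vertices
of V. At u = v both sides of the last clause are false. *)
Definition represents V s : Prop :=
  [/\ forall G, G \in s -> G \subset V,
      forall v, v \in V -> 0 < ncol s v
    & {in V &, forall u v, e u v = share s u v && (ncol s u < ncol s v)}].

Lemma represents_has_dir_rep s : represents setT s -> has_dir_rep e (size s).
Proof.
case=> _ s_gt0 sE.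
have card_tnth (a : pred {set T}) :
    #|[set i : 'I_(size s) | a (tnth (in_tuple s) i)]| = count a s.
  rewrite -[RHS]sum1_count (big_tnth _ _ s) /= -sum1_card.
  by apply: eq_bigl => i; rewrite inE.
apply/existsP.
exists [ffun v => [set i : 'I_(size s) | v \in tnth (in_tuple s) i]].
apply/andP; split.
  apply/forallP=> v; rewrite ffunE -card_gt0.
  by rewrite (card_tnth (fun G : {set T} => v \in G)) s_gt0 ?inE.
apply/forallP=> u; apply/forallP=> v; apply/implyP=> _; rewrite !ffunE.
rewrite sE ?inE // !(card_tnth (fun G : {set T} => _ \in G)).
rewrite (_ : _ :&: _ = [set i : 'I_(size s) |
  (u \in tnth (in_tuple s) i) && (v \in tnth (in_tuple s) i)]); last first.
  by apply/setP=> i; rewrite !inE.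
by rewrite (card_tnth (fun G => (u \in G) && (v \in G))) /share has_count.
Qed.

(** The number of ancestors increases along arcs. A rank function replaces
acyclicity from here on, since it restricts to any set of vertices. *)
Lemma acyclic_rank : acyclic e ->
  exists r : T -> nat, forall u v, e u v -> r u < r v.
Proof.
move=> acy; exists (fun v => #|[set u | connect e u v]|) => u v euv.
apply/proper_card/properP; split.
  by apply/subsetP=> w; rewrite !inE => /connect_trans; apply; apply: connect1.
exists v; rewrite !inE ?connect0 //; apply/negP=> /connectP[p pth lst].
case/shortenP: pth lst => q qp uq _ lst.
have /acy // : ucycle e (v :: q).
by rewrite /ucycle uq andbT /= rcons_path qp -lst.
Qed.

Lemma share_ncol s u v : share s u v -> (0 < ncol s u) && (0 < ncol s v).
Proof.
by case/hasP=> G Gs /andP[uG vG]; rewrite -!has_count; apply/andP; split;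
  apply/hasP; exists G.
Qed.

Lemma ncol_notin V s v :
  (forall G, G \in s -> G \subset V) -> v \notin V -> ncol s v = 0.
Proof.
move=> sV; apply: contraNeq; rewrite -lt0n -has_count => /hasP[G Gs].
exact: (subsetP (sV _ Gs)).
Qed.

Lemma share_notin V s u v :
  (forall G, G \in s -> G \subset V) -> (u \notin V) || (v \notin V) ->
  share s u v = false.
Proof.
move=> sV; apply: contraTF => /hasP[G /sV/subsetP GV /andP[uG vG]].
by rewrite !GV.
Qed.

Lemma share_sym s u v : share s u v = share s v u.
Proof. by apply: eq_has => G; rewrite andbC. Qed.

Variable r : T -> nat.
Hypothesis r_lt : forall u v, e u v -> r u < r v.

Lemma e_irr u : e u u = false.
Proof. by apply/negP=> /r_lt; rewrite ltnn. Qed.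

Lemma e_asym u v : e u v -> e v u = false.
Proof. by move=> /r_lt uv; apply/negP=> /r_lt; rewrite ltnNge ltnW. Qed.

(** * Adding a pair of vertices *)
Definition sees x G := [exists u in G, e u x].

(** Sets of old vertices that share a fresh color, each extended to x or y when
its members are in-neighbors of x or y. Sharing is sound on cliques, whose
members are already joined by arcs, and homogeneity lets the class be extended
without touching a non-neighbor. Monotonicity makes the growth of sizes
preserve all strict inequalities and all equalities between them; equal sizes
matter because non-adjacent vertices of equal size may share colors. *)
Record bumps V s x y gs : Prop := Bumps {
  bumps_sub : forall G, G \in gs -> G \subset V;
  bumps_clique : forall G u v, G \in gs -> u \in G -> v \in G ->
    u != v -> e u v || e v u;
  bumps_hom : forall G u v, G \in gs -> u \in G -> v \in G ->
    (e u x = e v x) * (e u y = e v y);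
  bumps_mono : {in V &, forall u v, ncol s u <= ncol s v ->
    ncol gs u <= ncol gs v};
  bumps_le1 : {in V, forall z, ncol gs z <= 1};
  bumps_cover : forall z, z \in V -> e z x || e z y -> 0 < ncol gs z }.

(** The p padding colors common to x and y also provide the witness of the arc
from x to y; without this arc, X = Y makes the shared colors harmless. *)
Lemma represents_add_pair V s x y gs X Y :
    represents V s -> bumps V s x y gs ->
    x \notin V -> y \notin V -> x != y -> e y x = false ->
    {in V, forall z, (e x z = false) * (e y z = false)} ->
    size gs < X -> (if e x y then X < Y else X == Y) ->
    {in V, forall z, e z x -> ncol s z + ncol gs z < X} ->
    {in V, forall z, e z y -> ncol s z + ncol gs z < Y} ->
  exists s', [/\ represents (x |: (y |: V)) s',
    size s' = size s + size gs +
              maxn (X - count (sees x) gs) (Y - count (sees y) gs),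
    ncol s' x = X, ncol s' y = Y
    & {in V, forall z, ncol s' z = ncol s z + ncol gs z}].
Proof.
move=> [sV s_gt0 sE] [gV gC gH gM _ gK] xV yV xy eyx sink.
set gx := count (sees x) gs; set gy := count (sees y) gs.
move=> ltX XY zX zY.
have XleY : X <= Y by case: ifP XY => _ => [/ltnW|/eqP->].
have gX : gx < X by apply: leq_ltn_trans (count_size _ _) ltX.
have gY : gy < Y by apply: leq_ltn_trans (count_size _ _) (leq_trans ltX XleY).
have yx : y != x by rewrite eq_sym.
have zx z : z \in V -> z != x by apply: contraTneq => ->.
have zy z : z \in V -> z != y by apply: contraTneq => ->.
pose ext G := [set z | [|| z \in G, (z == x) && sees x G
                                   | (z == y) && sees y G]].
pose p := minn (X - gx) (Y - gy).
pose s1 := map ext gs.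
pose s2 := nseq p [set x; y] ++ nseq (X - gx - p) [set x]
            ++ nseq (Y - gy - p) [set y].
have cntE v : ncol (s ++ s1 ++ s2) v = ncol s v + ncol s1 v + ncol s2 v.
  by rewrite /ncol !count_cat !addnA.
have shE u v : share (s ++ s1 ++ s2) u v
             = [|| share s u v, share s1 u v | share s2 u v].
  by rewrite /share !has_cat.
have G_notin G : G \in gs -> (x \notin G) * (y \notin G).
  by move=> /gV/subsetP GV; split; apply: contra (GV _) _.
have n1V z : z \in V -> ncol s1 z = ncol gs z.
  move=> zV; rewrite /ncol count_map; apply: eq_count => G /=.
  by rewrite inE (negPf (zx _ zV)) (negPf (zy _ zV)) !orbF.
have n1x : ncol s1 x = gx.
  rewrite /ncol count_map; apply: eq_in_count => G Gg /=.
  by rewrite inE eqxx (negPf xy) (negPf (G_notin _ Gg).1) /= orbF.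
have n1y : ncol s1 y = gy.
  rewrite /ncol count_map; apply: eq_in_count => G Gg /=.
  by rewrite inE eqxx (negPf yx) (negPf (G_notin _ Gg).2) /=.
have n2V z : z \in V -> ncol s2 z = 0.
  move=> zV; rewrite /ncol !count_cat !count_nseq !inE.
  by rewrite (negPf (zx _ zV)) (negPf (zy _ zV)).
have n2x : ncol s2 x = X - gx.
  rewrite /ncol !count_cat !count_nseq !inE eqxx (negPf xy) /= /p; lia.
have n2y : ncol s2 y = Y - gy.
  rewrite /ncol !count_cat !count_nseq !inE eqxx (negPf yx) /= /p; lia.
have ncV z : z \in V -> ncol (s ++ s1 ++ s2) z = ncol s z + ncol gs z.
  by move=> zV; rewrite cntE n1V // n2V // addn0.
have ncx : ncol (s ++ s1 ++ s2) x = X.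
  by rewrite cntE (ncol_notin sV xV) n1x n2x add0n subnKC // ltnW.
have ncy : ncol (s ++ s1 ++ s2) y = Y.
  by rewrite cntE (ncol_notin sV yV) n1y n2y add0n subnKC // ltnW.
have s2V z v : z \in V -> share s2 z v = false.
  by move=> zV; apply/negP=> /share_ncol; rewrite n2V.
have meet_sees w G z : G \in gs -> z \in G ->
    (forall u v, u \in G -> v \in G -> e u w = e v w) -> sees w G = e z w.
  move=> Gg zG hw; apply/exists_inP/idP => [[u uG]|]; first by rewrite (hw u z).
  by exists z.
have shx z : z \in V -> share (s ++ s1 ++ s2) z x = e z x.
  move=> zV; rewrite shE (share_notin sV) ?xV ?orbT // s2V // orbF /=.
  rewrite /share has_map; apply/hasP/idP => [[G Gg]|ezx] /=.
    rewrite !inE eqxx (negPf xy) (negPf (zx _ zV)) (negPf (zy _ zV)) /= !orbF.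
    rewrite (negPf (G_notin _ Gg).1) /= => /andP[zG].
    by rewrite (meet_sees x G z) // => u v uG vG; case: (gH _ _ _ Gg uG vG).
  have := gK z zV; rewrite ezx => /(_ isT); rewrite -has_count => /hasP[G Gg zG].
  exists G => //=; rewrite !inE zG eqxx /=; apply/orP; right; apply/orP; left.
  by apply/exists_inP; exists z.
have shy z : z \in V -> share (s ++ s1 ++ s2) z y = e z y.
  move=> zV; rewrite shE (share_notin sV) ?yV ?orbT // s2V // orbF /=.
  rewrite /share has_map; apply/hasP/idP => [[G Gg]|ezy] /=.
    rewrite !inE eqxx (negPf yx) (negPf (zx _ zV)) (negPf (zy _ zV)) /= !orbF.
    rewrite (negPf (G_notin _ Gg).2) /= => /andP[zG].
    by rewrite (meet_sees y G z) // => u v uG vG; case: (gH _ _ _ Gg uG vG).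
  have := gK z zV; rewrite ezy orbT => /(_ isT).
  rewrite -has_count => /hasP[G Gg zG].
  exists G => //=; rewrite !inE zG eqxx /=; apply/orP; right; apply/orP; right.
  by apply/exists_inP; exists z.
have shV u v : u \in V -> v \in V ->
    share (s ++ s1 ++ s2) u v = share s u v || share gs u v.
  move=> uV vV; rewrite shE s2V // orbF; congr (_ || _).
  rewrite /share has_map; apply: eq_has => G /=.
  by rewrite !inE !(negPf (zx _ _)) // !(negPf (zy _ _)) // !orbF.
have ltV : {in V &, forall u v, (ncol s u + ncol gs u < ncol s v + ncol gs v)
                              = (ncol s u < ncol s v)}.
  move=> u v uV vV; have := gM u v uV vV; have := gM v u vV uV.
  by move: (ncol s u) (ncol s v) (ncol gs u) (ncol gs v); clear; lia.
exists (s ++ s1 ++ s2); split=> //; last first.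
  rewrite !size_cat size_map !size_nseq /p; lia.
split.
- move=> G; rewrite !mem_cat => /or3P[/sV|/mapP[H /gV HV ->]|].
  + move=> GV; apply: subset_trans GV _; apply/subsetP=> z zV.
    by rewrite !inE zV !orbT.
  + apply/subsetP=> z; rewrite !inE.
    by case/or3P=> [/(subsetP HV)->|/andP[->]|/andP[->]]; rewrite ?orbT.
  + rewrite !mem_nseq.
    by case/or3P=> /andP[_ /eqP->]; apply/subsetP=> z;
      rewrite !inE => /[dup]; [case/orP | |] => /eqP-> _; rewrite eqxx ?orbT.
- move=> v; rewrite !inE => /or3P[/eqP->|/eqP->|vV]; 
    rewrite ?ncx ?ncy ?(leq_ltn_trans _ gX) ?(leq_ltn_trans _ gY) //.
  by rewrite ncV // addn_gt0 s_gt0.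
move=> u v; rewrite !inE.
case/or3P=> [/eqP->|/eqP->|uV] /or3P[/eqP->|/eqP->|vV].
- by rewrite e_irr ltnn andbF.
- rewrite ncx ncy; case: ifP XY => [exy XltY|exy /eqP->].
    rewrite XltY andbT shE; symmetry; apply/or3P/Or33.
    rewrite /share has_cat has_nseq !inE !eqxx orbT /=.
    by rewrite /p leq_min !subn_gt0 gX gY.
  by rewrite ltnn andbF.
- rewrite (sink _ vV).1 share_sym shx //.
  case evx: (e v x) => //=; rewrite ncx ncV //.
  by rewrite ltnNge ltnW // zX.
- rewrite eyx ncx ncy; case: ifP XY => [_ XltY|_ /eqP->].
    by rewrite ltnNge (ltnW XltY) andbF.
  by rewrite ltnn andbF.
- by rewrite e_irr ltnn andbF.
- rewrite (sink _ vV).2 share_sym shy //.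
  case evy: (e v y) => //=; rewrite ncy ncV //.
  by rewrite ltnNge ltnW // zY.
- rewrite shx // ncx ncV //; case eux: (e u x) => //=.
  by rewrite zX.
- rewrite shy // ncy ncV //; case euy: (e u y) => //=.
  by rewrite zY.
rewrite shV // !ncV // ltV // sE //.
case sg: (share gs u v); rewrite ?orbF // orbT /=.
have [->|uv] := eqVneq u v; first by rewrite ltnn andbF.
case/hasP: sg => G Gg /andP[uG vG].
have := gC _ _ _ Gg uG vG uv; rewrite !sE //.
by case: ltngtP; rewrite ?andbF ?andbT //= ?orbF.
Qed.

(** * Choosing the fresh colors *)
Definition singles (l : seq T) := [seq [set z] | z <- l].

Lemma ncol_singles l z : uniq l -> ncol (singles l) z = (z \in l).
Proof.
move=> ul; rewrite /ncol count_map -(count_uniq_mem z ul).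
by apply: eq_count => w /=; rewrite inE eq_sym.
Qed.

Lemma bumps_all V s x y : bumps V s x y (singles (enum V)).
Proof.
have nE z : ncol (singles (enum V)) z = (z \in V).
  by rewrite ncol_singles ?enum_uniq // mem_enum.
split.
- by move=> G /mapP[z]; rewrite mem_enum => zV ->; rewrite sub1set.
- by move=> G u v /mapP[z _ ->]; rewrite !inE => /eqP-> /eqP->; rewrite eqxx.
- by move=> G u v /mapP[z _ ->]; rewrite !inE => /eqP-> /eqP->.
- by move=> u v uV vV _; rewrite !nE uV vV.
- by move=> z zV; rewrite nE zV.
- by move=> z zV _; rewrite nE zV.
Qed.

(** A Hamiltonian path of the digraph induced on V, as a boolean so that the
induction can branch on it. *)
Definition traceable V := has (sorted e) (permutations (enum V)).

Lemma sorted_rank q : sorted e q -> pairwise (fun u v => r u < r v) q.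
Proof.
move=> qs; rewrite -sorted_pairwise; last by move=> ? ? ?; apply: ltn_trans.
exact: sub_sorted qs.
Qed.

Lemma sorted_uniq_rank q : sorted e q -> uniq q.
Proof.
move=> /sorted_rank; apply: pairwise_uniq => u; exact: ltnn.
Qed.

Lemma traceableP V :
  reflect (exists2 q, sorted e q & q =i V) (traceable V).
Proof.
apply: (iffP hasP) => [[q]|[q qs qV]].
  rewrite mem_permutations => /perm_mem qV; exists q => // z.
  by rewrite qV mem_enum.
exists q => //; rewrite mem_permutations uniq_perm ?enum_uniq //.
  exact: sorted_uniq_rank.
by move=> z; rewrite qV mem_enum.
Qed.

Lemma sorted_ncol V s q : represents V s -> sorted e q -> q =i V ->
  pairwise (fun u v => ncol s u < ncol s v) q.
Proof.
move=> [_ _ sE] qs qV; rewrite -sorted_pairwise; last first.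
  by move=> ? ? ?; apply: ltn_trans.
apply: (sub_in_sorted (P := mem V)) qs; last by apply/allP => z; rewrite qV.
by move=> u v uV vV /=; rewrite sE // => /andP[].
Qed.

Lemma path_or_break (R : rel T) v q :
  path R v q \/
  exists q1 u w q2, v :: q = q1 ++ [:: u, w & q2] /\ ~~ R u w.
Proof.
elim: q v => [|w q IHq] v /=; first by left.
have [Rvw|nRvw] := boolP (R v w); last first.
  by right; exists [::], v, w, q.
case: (IHq w) => [->|[q1 [u [w' [q2 [-> nR]]]]]]; [by left|right].
by exists (v :: q1), u, w', q2.
Qed.

Lemma path_alternate (a : pred T) v q :
  path (fun u w => a u != a w) v q -> a (last v q) = a v (+) odd (size q).
Proof.
elim: q v => [|w q IHq] v /=; first by rewrite addbF.
by case/andP=> avw /IHq->; case: (a v) (a w) avw => [] [] //=; case: odd.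
Qed.

(** The arc from u to w already separates their sizes, so that one color can
serve for both. *)
Lemma bumps_merge V x y s q1 u w q2 : sorted e (q1 ++ [:: u, w & q2]) ->
    q1 ++ [:: u, w & q2] =i V -> e u x = e w x ->
    {in V, forall z, e z y = false} ->
  bumps V s x y ([set u; w] :: singles (q1 ++ q2)).
Proof.
move=> qs qV ux yV.
have euw : e u w by have := cat_sorted2 qs => -[_] /= /andP[].
have uq := sorted_uniq_rank qs.
have perm_q : perm_eq (q1 ++ [:: u, w & q2]) [:: u, w & q1 ++ q2].
  by rewrite perm_catC /= !perm_cons perm_catC.
have [[uV wV] q12V] : (u \in V) * (w \in V) * {subset q1 ++ q2 <= V}.
  split; first by split; rewrite -qV mem_cat !inE eqxx ?orbT.
  by move=> z zq; rewrite -qV (perm_mem perm_q) !inE zq !orbT.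
have nE z : z \in V -> ncol ([set u; w] :: singles (q1 ++ q2)) z = 1.
  move: uq; rewrite (perm_uniq perm_q) => uq zV.
  have := zV; rewrite /= !inE -qV (perm_mem perm_q) !inE.
  rewrite -/(ncol _ z) ncol_singles; last by case/and3P: uq.
  move: uq; rewrite /= inE negb_or => /and3P[/andP[uw uq1] wq1 _].
  have [->|_] := eqVneq z u; first by rewrite (negPf uq1).
  have [->|_] := eqVneq z w; first by rewrite (negPf wq1).
  by move=> /= ->.
split.
- move=> G; rewrite inE => /predU1P[->|/mapP[z /q12V zV ->]].
    by apply/subsetP=> z; rewrite !inE => /orP[]/eqP->.
  by rewrite sub1set.
- move=> G v v'; rewrite inE => /predU1P[->|/mapP[z _ ->]]; rewrite !inE.
    by case/orP=> /eqP-> /orP[]/eqP->; rewrite ?eqxx // euw ?orbT.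
  by move=> /eqP-> /eqP->; rewrite eqxx.
- move=> G v v'; rewrite inE => /predU1P[->|/mapP[z _ ->]]; rewrite !inE.
    by case/orP=> /eqP-> /orP[]/eqP->; rewrite ?ux ?yV.
  by move=> /eqP-> /eqP->.
- by move=> z z' zV z'V _; rewrite !nE.
- by move=> z zV; rewrite nE.
- by move=> z zV _; rewrite nE.
Qed.

(** The first vertex v of a Hamiltonian path has the smallest size, so leaving it
unchanged while all others grow preserves the order. *)
Lemma bumps_skip V x y s v q : represents V s -> sorted e (v :: q) ->
    v :: q =i V -> e v x = false -> {in V, forall z, e z y = false} ->
  bumps V s x y (singles q).
Proof.
move=> sV qs qV vx yV.
have /= /andP[vq uq] := sorted_uniq_rank qs.
split.
- by move=> G /mapP[z zq ->]; rewrite sub1set -qV inE zq orbT.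
- by move=> G z w /mapP[z' _ ->]; rewrite !inE => /eqP-> /eqP->; rewrite eqxx.
- by move=> G z w /mapP[z' _ ->]; rewrite !inE => /eqP-> /eqP->.
- move=> z w zV; rewrite !ncol_singles // -qV inE => /predU1P[->|->]; last first.
    by case: (_ \in _).
  have /= /andP[/allP lt_v _] := sorted_ncol sV qs qV.
  by case zq: (z \in q) => //; rewrite leqNgt lt_v.
- by move=> z _; rewrite ncol_singles // leq_b1.
- move=> z; rewrite -qV inE ncol_singles // => /predU1P[->|->] //.
  by rewrite vx yV // -qV mem_head.
Qed.

(** If no arc of the path can be merged, membership in the in-neighborhood of x
alternates along it; the path has an even number of vertices and its last one
is an in-neighbor, so its first one is not. *)
Lemma bumps_save V x y s v q : represents V s -> sorted e (v :: q) ->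
    v :: q =i V -> odd (size q) -> e (last v q) x ->
    {in V, forall z, e z y = false} ->
  exists2 gs, bumps V s x y gs & size gs = size q.
Proof.
move=> sV qs qV oq lx yV.
case: (path_or_break (fun u w => e u x != e w x) v q); last first.
  case=> q1 [u [w [q2 [E]]]]; rewrite negbK => /eqP ux.
  exists ([set u; w] :: singles (q1 ++ q2)).
    by apply: bumps_merge; rewrite -?E.
  by have /(congr1 size) := E; rewrite /= size_map !size_cat /=; lia.
move=> /(path_alternate (a := e^~ x)); rewrite lx oq addbT => /esym/negbTE vx.
by exists (singles q); rewrite ?size_map //; apply: bumps_skip vx yV.
Qed.

(** * The induction on pairs *)
(** The quadratic bound with m pairs, doubled and without subtraction; its
constant term is withheld at m = 0, where no color is needed. The bounds on the
sizes are what keeps the next pair affordable. *)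
Definition attained m V := exists s, [/\ represents V s,
  2 * size s + 3 * m <= 5 * m ^ 2 + 2 * (0 < m),
  {in V, forall v, ncol s v < 3 * m}
  & ~~ traceable V -> {in V, forall v, (ncol s v).+1 < 3 * m}].

Lemma budget_step m a b : 2 * a + 3 * m <= 5 * m ^ 2 + 2 * (0 < m) ->
    b <= (if m == 0 then 2 else 5 * m + 1) ->
  2 * (a + b) + 3 * m.+1 <= 5 * m.+1 ^ 2 + 2 * (0 < m.+1).
Proof. by case: m => [|m] /=; nia. Qed.

Lemma exists_sink V : V != set0 ->
  exists2 x, x \in V & {in V, forall z, e x z = false}.
Proof.
case/set0Pn=> z0 z0V; case: (@arg_maxnP _ z0 (mem V) r z0V) => x xV xmax.
by exists x => // z /xmax; apply: contraTF => /r_lt; rewrite ltnNge.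
Qed.

(** An old in-neighbor of y saves a padding color of y; when there is none, the
saving comes from the fresh colors. The first pair may cost two colors because
of the constant term of the bound. *)
Lemma bumps_traceable m V s x y q : represents V s -> sorted e q -> q =i V ->
    size q = 2 * m -> (q != [::] -> e (last x q) x) ->
  exists gs, [/\ bumps V s x y gs, size gs <= 2 * m &
    size gs + maxn (3 * m + 1 - count (sees x) gs)
                   (3 * m + 2 - count (sees y) gs)
      <= if m == 0 then 2 else 5 * m + 1].
Proof.
move=> sV qs qV sq lx.
have cV : #|V| = 2 * m.
  by rewrite -(eq_card qV) (card_uniqP (sorted_uniq_rank qs)).
have sz_all : size (singles (enum V)) = 2 * m by rewrite size_map -cardE.
have [/exists_inP[z zV ezy]|] := boolP [exists z in V, e z y].
  have gy : 0 < count (sees y) (singles (enum V)).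
    rewrite -has_count; apply/hasP; exists [set z].
      by apply: map_f; rewrite mem_enum.
    by apply/exists_inP; exists z; rewrite ?inE.
  have m_gt0 : 0 < #|V| by apply/card_gt0P; exists z.
  exists (singles (enum V)); rewrite sz_all leqnn.
  split=> //; first exact: bumps_all.
  rewrite cV in m_gt0; move: gy; rewrite gtn_eqF; last by clear -m_gt0; lia.
  by move: (count _ _) (count _ _); clear; lia.
rewrite negb_exists_in => /forall_inP nV.
have yV : {in V, forall z, e z y = false} by move=> z /nV/negbTE.
case: (posnP m) => [m0|m0].
  exists (singles (enum V)); rewrite sz_all leqnn.
  split=> //; first exact: bumps_all.
  by rewrite m0; move: (count _ _) (count _ _); clear; lia.
case: q {cV} qs lx sq qV => [|v q] /= qs lx sq qV.
  by move: sq m0; clear; lia.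
have oq : odd (size q) by move: sq m0; clear; lia.
have [gs bg sg] := bumps_save sV qs qV oq (lx isT) yV.
exists gs; split=> //; rewrite sg; first by move: sq; clear; lia.
by move: sq (count _ _) (count _ _); clear; lia.
Qed.

(** Removing the last two vertices of a Hamiltonian path leaves a traceable
digraph whose path ends at an in-neighbor of x. *)
Lemma step_traceable m V : traceable V -> #|V| = 2 * m.+1 ->
  (forall V0 : {set T}, #|V0| = 2 * m -> attained m V0) -> attained m.+1 V.
Proof.
move=> /[dup] trV /traceableP[q qs qV] cV IH.
have sq : size q = 2 * m.+1.
  by rewrite -cV -(eq_card qV) (card_uniqP (sorted_uniq_rank qs)).
case/lastP: q qs qV sq => [|q y] //; case/lastP: q => [|q x].
  by rewrite size_rcons /=; lia.
rewrite !size_rcons => qs qV sq.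
have := sorted_uniq_rank qs.
rewrite !rcons_uniq mem_rcons inE negb_or eq_sym => /andP[/andP[xy yq]].
case/andP=> xq uq.
have qs0 : sorted e q.
  by move: qs; rewrite -!cats1 -catA => /cat_sorted2[].
have [lx exy] : (q != [::] -> e (last x q) x) /\ e x y.
  case: (q) qs => [|v q'] /=; first by rewrite andbT.
  by rewrite !rcons_path last_rcons => /andP[/andP[_ ->] ->].
have := sorted_rank qs; rewrite -!cats1 -catA pairwise_cat => /and3P[/allrelP rk _ _].
pose V0 := [set z in q].
have qV0 : q =i V0 by move=> z; rewrite inE.
have cV0 : #|V0| = 2 * m by rewrite -(eq_card qV0) (card_uniqP uq); move: sq; clear; lia.
have VE : V = x |: (y |: V0).
  by apply/setP=> z; rewrite -qV !inE !mem_rcons !inE mem_rcons inE orbCA.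
have [s [sV sz sb _]] := IH _ cV0.
have sink : {in V0, forall z, (e x z = false) * (e y z = false)}.
  move=> z; rewrite -qV0 => zq.
  split; apply/negP=> /r_lt; rewrite ltnNge ltnW // rk // !inE eqxx ?orbT //.
have sq0 : size q = 2 * m by move: sq; clear; lia.
have [gs [bg szg cost]] := bumps_traceable y sV qs0 qV0 sq0 lx.
have xV : x \notin V0 by rewrite -qV0.
have yV : y \notin V0 by rewrite -qV0.
have g1 := bumps_le1 bg.
have [s' [s'V s's s'x s'y s'z]] : exists s', [/\ represents V s',
    size s' = size s + size gs + maxn (3 * m + 1 - count (sees x) gs)
                                      (3 * m + 2 - count (sees y) gs),
    ncol s' x = 3 * m + 1, ncol s' y = 3 * m + 2
    & {in V0, forall z, ncol s' z = ncol s z + ncol gs z}].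
  have b3 z : z \in V0 -> ncol s z + ncol gs z <= 3 * m.
    by move=> zV; move: (sb z zV) (g1 z zV); clear; lia.
  rewrite VE; apply: represents_add_pair => //; rewrite ?exy ?(e_asym exy) //.
  - by move: szg; clear; lia.
  - by clear; lia.
  - by move=> z /b3 zb _; move: zb; clear; lia.
  - by move=> z /b3 zb _; move: zb; clear; lia.
exists s'; split=> //.
- by rewrite s's -addnA; apply: budget_step.
- move=> z; rewrite VE !in_setU1 => /or3P[/eqP->|/eqP->|zV].
  + by rewrite s'x; clear; lia.
  + by rewrite s'y; clear; lia.
  + by rewrite s'z //; move: (sb z zV) (g1 z zV); clear; lia.
by rewrite trV.
Qed.

(** Here x and y are successive sinks. Without the arc from x to y, size 3m + 1
for both respects the smaller bound. With it, x has to get size 3m, hence its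
in-neighbors z need an old size below 3m - 1. This is known if the rest is
untraceable; if the rest is traceable, only the end of its path may be larger,
and this end is no in-neighbor of x, lest the path extend through x and y. *)
Lemma step_untraceable m V : ~~ traceable V -> #|V| = 2 * m.+1 ->
  (forall V0 : {set T}, #|V0| = 2 * m -> attained m V0) -> attained m.+1 V.
Proof.
move=> ntV cV IH.
have [y yV ysink] : exists2 y, y \in V & {in V, forall z, e y z = false}.
  by apply: exists_sink; rewrite -card_gt0 cV.
have cVy : #|V :\ y| = 2 * m + 1.
  by have := cardsD1 y V; rewrite yV cV; clear; lia.
have [x xVy xsink] :
    exists2 x, x \in V :\ y & {in V :\ y, forall z, e x z = false}.
  by apply: exists_sink; rewrite -card_gt0 cVy addn1.
have /andP[xy xV] : (x != y) && (x \in V) by move: xVy; rewrite !inE.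
pose V0 := V :\ y :\ x.
have cV0 : #|V0| = 2 * m.
  by have := cardsD1 x (V :\ y); rewrite xVy cVy /V0; clear; lia.
have VE : V = x |: (y |: V0) by rewrite /V0 setUCA !setD1K.
have xV0 : x \notin V0 by rewrite !inE eqxx.
have yV0 : y \notin V0 by rewrite !inE eqxx andbF.
have V0V : {subset V0 <= V} by move=> z; rewrite !inE => /and3P[].
have sink : {in V0, forall z, (e x z = false) * (e y z = false)}.
  move=> z zV; split; last exact/ysink/V0V.
  by apply: xsink; move: zV; rewrite !inE => /andP[].
have eyx : e y x = false by apply: ysink.
have [s [sV sz sb sb']] := IH _ cV0.
have bg := bumps_all V0 s x y.
set gs := singles _ in bg.
have szg : size gs = 2 * m by rewrite size_map -cardE.
have g1 := bumps_le1 bg.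
have b3 z : z \in V0 -> ncol s z + ncol gs z <= 3 * m.
  by move=> zV; move: (sb z zV) (g1 z zV); clear; lia.
suff [X [Y [XY Y_le X_gt zX zY]]] : exists X Y, [/\
    if e x y then X < Y else X == Y, X <= Y <= 3 * m + 1, 2 * m < X,
    {in V0, forall z, e z x -> ncol s z + ncol gs z < X}
    & {in V0, forall z, e z y -> ncol s z + ncol gs z < Y}].
  have [s' [s'V s's s'x s'y s'z]] : exists s', [/\ represents V s',
      size s' = size s + size gs + maxn (X - count (sees x) gs)
                                        (Y - count (sees y) gs),
      ncol s' x = X, ncol s' y = Y
      & {in V0, forall z, ncol s' z = ncol s z + ncol gs z}].
    by rewrite VE; apply: represents_add_pair; rewrite ?szg.
  have b z : z \in V -> (ncol s' z).+1 < 3 * m.+1.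
    rewrite VE !in_setU1 => /or3P[/eqP->|/eqP->|zV].
    + by rewrite s'x; move: Y_le; clear; lia.
    + by rewrite s'y; move: Y_le; clear; lia.
    + by rewrite s'z //; move: (b3 z zV); clear; lia.
  exists s'; split=> //; last by move=> z /b /ltnW.
  rewrite s's -addnA; apply: budget_step => //; rewrite szg.
  by move: Y_le X_gt (count _ _) (count _ _); clear; case: m => [|m] /=; lia.
case exy: (e x y); last first.
  exists (3 * m + 1), (3 * m + 1); split; rewrite ?leqnn ?addn1 ?ltnS //.
  - by clear; lia.
  - by move=> z /b3.
  - by move=> z /b3.
exists (3 * m), (3 * m + 1).
(* Two vertices joined by an arc already form a path. *)
have m_gt0 : 0 < m.
  rewrite lt0n; apply: contraNneq ntV => m0.
  apply/traceableP; exists [:: x; y]; first by rewrite /= exy.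
  move: cV0; rewrite m0 => /cards0_eq V00 z.
  by rewrite VE V00 !inE orbF.
have zX : {in V0, forall z, e z x -> (ncol s z).+1 < 3 * m}.
  move=> z zV ezx; have [/traceableP[q qs qV]|/sb'] := boolP (traceable V0).
    (* Sizes increase along the path, so only its end w can have size 3m - 1. *)
    case/lastP: q qs qV => [|q w] qs qV; first by move: zV; rewrite -qV.
    have := sorted_ncol sV qs qV.
    rewrite -cats1 pairwise_cat => /and3P[/allrelP lt_w _ _].
    have wV : w \in V0 by rewrite -qV mem_rcons mem_head.
    move: zV; rewrite -qV mem_rcons inE => /predU1P[zw|zq]; last first.
      by move: (lt_w z w zq) (sb w wV); rewrite inE eqxx; clear; lia.
    case/traceableP: ntV; exists (rcons (rcons (rcons q w) x) y).
      rewrite -zw in qs *.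
      by case: (q) qs => [|v q'] /=; rewrite ?ezx ?exy // !rcons_path !last_rcons
        => -> /=; rewrite ezx exy.
    by move=> z'; rewrite VE mem_rcons inE mem_rcons inE qV !inE orbCA.
  exact.
split.
- by rewrite addn1.
- by rewrite addn1 leqnSn leqnn.
- by move: m_gt0; clear; lia.
- by move=> z zV /(zX z zV); move: (g1 z zV); clear; lia.
- by move=> z /b3; rewrite addn1.
Qed.

Lemma attained_all m V : #|V| = 2 * m -> attained m V.
Proof.
elim: m V => [|m IHm] V cV.
  have nV v : (v \in V) = false by rewrite (cards0_eq cV) inE.
  exists [::]; split=> // [|v|_ v]; rewrite ?nV //.
  by split=> // [v|u v]; rewrite nV.
have [tV|ntV] := boolP (traceable V).
  exact: step_traceable IHm.
exact: step_untraceable IHm.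
Qed.

End ColorClasses.

Theorem theorem2p4 (n : nat) (T : finType) (e : rel T)
    (n_gt0 : (0 < n)%N) (n_even : ~~ odd n)
    (e_irr : irreflexive e) (e_acy : acyclic e) (card_T : #|T| = n) :
  (DIN e_acy)%:R <= 5 * n%:R ^+ 2 / 8 - 3 * n%:R / 4 + 1 :> rat.
Proof.
have [r r_lt] := acyclic_rank e_acy.
have n2 : n = (2 * n./2)%N by rewrite mul2n even_halfK.
have cT : #|[set: T]| = (2 * n./2)%N by rewrite cardsT card_T.
have [s [sT sz _ _]] := attained_all r_lt cT.
have le_s : (DIN e_acy <= size s)%N.
  rewrite /DIN; case: ex_minnP => k _ ->//.
  exact: represents_has_dir_rep.
have le_n : (8 * DIN e_acy + 6 * n <= 5 * (n * n) + 8)%N.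
  move: sz le_s n2 {n_even card_T cT}; case: n./2 => [|m]; first by lia.
  by rewrite ltnS leq0n muln1; nia.
move: le_n; rewrite -(ler_nat rat) !natrD !natrM => le_n; lra.
Qed.
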